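(* There exist an ergodic measure-preserving $\mathbb{Z}^2$ dynamical system $(\Omega,\mathcal{F},\mathbb{P},\{T^z\}_{z\in\mathbb{Z}^2})$ and a measurable stationary arrow map $\alpha:\Omega\times\mathbb{Z}^2\to\{e_1,e_2\}$, defining a walk $X_z$ from every point $z\in\mathbb{Z}^2$, such that almost surely all walks coalesce but no walk has an asymptotic direction.
   Context: The arrow map is stationary if $\alpha(\omega,z)=\alpha(T^z\omega,\mathbf{0})$ for all $z$ almost surely. The walks are $X_z(\omega,0)=z$, $X_z(\omega,k+1)=X_z(\omega,k)+\alpha(\omega,X_z(\omega,k))$ for $k\ge0$. All walks coalesce means that for all $x,y\in\mathbb{Z}^2$ there are $k_0,k_1\ge0$ with $X_x(\omega,k_0)=X_y(\omega,k_1)$. A walk $X$ has an asymptotic direction if $X(k)/|X(k)|$ converges as $k\to\infty$. *)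

(* Defs.v *)
From HB Require Import structures.
From mathcomp Require Import all_boot all_order all_algebra.
From mathcomp Require Import all_classical all_reals all_analysis.
Set Implicit Arguments.
Unset Strict Implicit.
Unset Printing Implicit Defensive.
Import Order.TTheory GRing.Theory Num.Theory.
Import numFieldNormedType.Exports.
Local Open Scope classical_set_scope.
Local Open Scope ring_scope.

(* The lattice carries the discrete sigma-algebra, so that measurability of a
   map on Omega * Z2 is joint measurability for the product sigma-algebra. *)
Definition Z2 : Type := (int * int)%type.
HB.instance Definition _ := GRing.Zmodule.on Z2.
HB.instance Definition _ := isPointed.Build Z2 (0 : Z2).
HB.instance Definition _ := @isMeasurable.Build default_measure_display
  Z2 discrete_measurable discrete_measurable0
  discrete_measurableC discrete_measurableU.

Definition e1 : Z2 := (1, 0).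
Definition e2 : Z2 := (0, 1).

Definition measure_preserving (d : measure_display) (Omega : measurableType d)
    (R : realType) (P : probability Omega R) (f : Omega -> Omega) : Prop :=
  measurable_fun setT f /\
  forall A : set Omega, measurable A -> P (f @^-1` A) = P A.

Definition dynamical_system (d : measure_display) (Omega : measurableType d)
    (R : realType) (P : probability Omega R) (T : Z2 -> Omega -> Omega)
    : Prop :=
  [/\ T 0 = id,
      forall y z : Z2, T (y + z) = T y \o T z
    & forall z : Z2, measure_preserving P (T z)].

(* Invariance is under the whole action, not under each T z separately. *)
Definition ergodic (d : measure_display) (Omega : measurableType d)
    (R : realType) (P : probability Omega R) (T : Z2 -> Omega -> Omega)
    : Prop :=
  forall A : set Omega, measurable A ->
    (forall z : Z2, T z @^-1` A = A) -> P A = 0%E \/ P A = 1%E.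

Definition arrow_map (d : measure_display) (Omega : measurableType d)
    (alpha : Omega * Z2 -> Z2) : Prop :=
  measurable_fun setT alpha /\
  forall p : Omega * Z2, alpha p = e1 \/ alpha p = e2.

Definition stationary (d : measure_display) (Omega : measurableType d)
    (R : realType) (P : probability Omega R) (T : Z2 -> Omega -> Omega)
    (alpha : Omega * Z2 -> Z2) : Prop :=
  {ae P, forall w : Omega, forall z : Z2, alpha (w, z) = alpha (T z w, 0)}.

Fixpoint walk (Omega : Type) (alpha : Omega * Z2 -> Z2) (w : Omega) (z : Z2)
    (k : nat) : Z2 :=
  if k is k'.+1
  then walk alpha w z k' + alpha (w, walk alpha w z k')
  else z.

Definition all_coalesce (Omega : Type) (alpha : Omega * Z2 -> Z2) (w : Omega)
    : Prop :=
  forall x y : Z2, exists k0 k1 : nat, walk alpha w x k0 = walk alpha w y k1.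

Definition euclidean_norm (R : realType) (x : Z2) : R :=
  Num.sqrt (x.1%:~R ^+ 2 + x.2%:~R ^+ 2).

(* At x = 0 this is (0, 0), as 0^-1 = 0; a walk with steps e1 and e2 visits
   the origin at most once, so this does not affect limits along it. *)
Definition direction (R : realType) (x : Z2) : R * R :=
  (x.1%:~R / euclidean_norm R x, x.2%:~R / euclidean_norm R x).

Definition has_asymptotic_direction (R : realType) (X : nat -> Z2) : Prop :=
  exists v : R * R, direction R (X k) @[k --> \oo] --> v.

(* Main.v *)
(** Take for Omega the 2-adic torus with Z^2 acting by translation.  A column
or row has level >= n when its 2-adic coordinate vanishes modulo 2^n, and at
every lattice point the arrow follows the line of higher level, the row in
case of a tie.  A cell bounded by lines of level >= n is crossed by no such
line, so every walk starting in it leaves through its upper right corner;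
hence walks starting in a common cell coalesce.  When the level n cell of z is
the lower left quarter of the level n+1 cell of z, the centre of the big cell
is a tie: the walk from z goes from there horizontally by 2^n to the right
side and then vertically by 2^n to the corner, which rotates its direction by
an angle bounded below.  Such n have conditional probability 1/4 at every
level, so almost surely there are infinitely many of them, for all z
simultaneously; this prevents convergence of the direction and also puts any
two points in a common cell. *)
Require Import Defs.
From HB Require Import structures.
From mathcomp Require Import all_boot all_order all_algebra.
From mathcomp Require Import all_classical all_reals all_analysis.
From mathcomp Require Import zify ring lra.
Set Implicit Arguments.
Unset Strict Implicit.
Unset Printing Implicit Defensive.
Import Order.TTheory GRing.Theory Num.Theory.
Import numFieldNormedType.Exports.
Local Open Scope classical_set_scope.
Local Open Scope ring_scope.

(** * Arrows read off 2-adic positions, and elementary facts on walks *)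

(* [A n] is the position modulo [2 ^ n]: the column (row) through the origin has
   level at least [n] when [2 ^ n] divides the first (second) coordinate. *)
Definition odometer_arrow (A : nat -> Z2) : Z2 :=
  if `[< forall n, (2 ^+ n %| (A n).1)%Z -> (2 ^+ n %| (A n).2)%Z >]
  then e1 else e2.

Lemma odometer_arrow_e1_or_e2 A :
  odometer_arrow A = e1 \/ odometer_arrow A = e2.
Proof. by rewrite /odometer_arrow; case: ifP; [left|right]. Qed.

Definition coherent (A : nat -> Z2) : Prop :=
  forall n, (2 ^+ n %| (A n.+1).1 - (A n).1)%Z /\
            (2 ^+ n %| (A n.+1).2 - (A n).2)%Z.

Lemma coherent_le (A : nat -> Z2) (m n : nat) : coherent A -> (m <= n)%N ->
  (2 ^+ m %| (A n).1 - (A m).1)%Z /\ (2 ^+ m %| (A n).2 - (A m).2)%Z.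
Proof.
move=> cA; elim: n => [|n IHn].
  by rewrite leqn0 => /eqP ->; rewrite !subrr.
rewrite leq_eqVlt ltnS => /predU1P[->|mn]; first by rewrite !subrr.
have [d1 d2] := IHn mn; have [h1 h2] := cA n.
have dmn : (2 ^+ m %| 2 ^+ n)%Z by exact: dvdz_exp2l.
have addBB (x y z : int) : x - z = x - y + (y - z) by ring.
split; [rewrite (addBB _ (A n).1)|rewrite (addBB _ (A n).2)];
  by rewrite rpredD// (dvdz_trans dmn).
Qed.

Lemma walkD (Omega : Type) (alpha : Omega * Z2 -> Z2) (w : Omega) (p : Z2)
    (k l : nat) :
  walk alpha w p (k + l) = walk alpha w (walk alpha w p k) l.
Proof. by elim: l => [|l IHl]; rewrite ?addn0// addnS /= IHl. Qed.

(** The coordinate sum is a clock: a point far out along the walk is visited late. *)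
Lemma walk_weight (Omega : Type) (alpha : Omega * Z2 -> Z2) (w : Omega)
    (p : Z2) (k : nat) : (forall q, alpha (w, q) = e1 \/ alpha (w, q) = e2) ->
  (walk alpha w p k).1 + (walk alpha w p k).2 = p.1 + p.2 + k%:Z.
Proof.
move=> a12; elim: k => [|k /= IHk]; first by rewrite addr0.
set q := walk _ _ _ _ in IHk *.
have [->|->] := a12 q; rewrite /e1 /e2 /=; lia.
Qed.

(** * Binary digits of integers *)

Lemma ltz_exp2n (n : nat) : n%:Z < 2 ^+ n.
Proof.
by have := ltn_expl n (isT : (1 < 2)%N); rewrite -ltz_nat -(natz (2 ^ n)) natrX.
Qed.

(** The digit of weight [2 ^ n] in the 2-adic expansion of [x], which makes sense for negative [x]
    too. *)
Definition bit (n : nat) (x : int) : bool := 2 ^+ n <= (x %% 2 ^+ n.+1)%Z.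

Lemma bitP n x : bit n x ->
  exists2 v : nat, v%:Z < 2 ^+ n & (2 ^+ n.+1 %| x - (v%:Z + 2 ^+ n))%Z.
Proof.
rewrite /bit => b; have L_gt0 : 0 < 2 ^+ n.+1 :> int by exact: exprn_gt0.
have lt := ltz_pmod x L_gt0.
exists `|(x %% 2 ^+ n.+1)%Z - 2 ^+ n|%N; rewrite abszE ger0_norm ?subr_ge0//.
  by move: lt; rewrite [X in _ < X -> _]exprS; lia.
by rewrite subrK {1}(divz_eq x (2 ^+ n.+1)) addrK dvdz_mull.
Qed.

Lemma bit_cong n x y : (2 ^+ n.+1 %| x - y)%Z -> bit n x = bit n y.
Proof. by rewrite -eqz_mod_dvd /bit => /eqP ->. Qed.

(** This flip is the symmetry that later gives each digit probability one half. *)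
Lemma bitB n x : bit n (x - 2 ^+ n) = ~~ bit n x.
Proof.
rewrite /bit exprS; have := exprn_gt0 n (ltr0n int 2).
move: (2 ^+ n) => L L_gt0.
have x_lt := ltz_pmod x (mulr_gt0 (ltr0n int 2) L_gt0 : 0 < 2 * L).
have x_ge : 0 <= (x %% (2 * L))%Z by rewrite modz_ge0// mulf_neq0// gt_eqF.
rewrite -modzDml; move: (x %% _)%Z x_lt x_ge => m m_lt m_ge.
have [Lm|mL] := leP L m; first by rewrite modz_small; lia.
by rewrite -(modzDr (m - L)) modz_small; lia.
Qed.

Lemma dvdz_bit n x y :
  (2 ^+ n.+1 %| x - y)%Z = (2 ^+ n %| x - y)%Z && (bit n x == bit n y).
Proof.
apply/idP/andP => [xy|[/dvdzP[q qE]]].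
  split; first by apply: dvdz_trans xy; exact: dvdz_exp2l.
  by apply/eqP; exact: bit_cong.
have [c [k qk]] : exists (c : bool) k, q = 2 * k + (if c then 1 else 0).
  by exists ((q %% 2)%Z == 1), (q %/ 2)%Z; case: eqP; lia.
(* For an odd quotient, [x - 2 ^ n] rather than [x] agrees with [y] modulo [2 ^ n.+1], so the digits
   of [x] and [y] differ. *)
case: c qk => qk; last first.
  by move=> _; apply/dvdzP; exists k; rewrite qE qk exprS; ring.
have : bit n (x - 2 ^+ n) = bit n y.
  by apply: bit_cong; apply/dvdzP; exists k; rewrite addrAC qE qk exprS; ring.
by rewrite bitB => <-; case: (bit n x).
Qed.

(** * Directions in the plane *)

(** The cross product of the two directions is the sine of the angle between them. The determinant
    of [x] and [y] is [x.1 * L], at least [3/4 L^2], while the norms are at most [4 L] and [5 L]; so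
    the sine is at least 3/80. *)
Lemma direction_cross (R : realType) (x y : Z2) (L : int) : 0 < L ->
  y.1 = x.1 -> y.2 = x.2 + L ->
  3 * L <= 4 * x.1 <= 9 * L -> - L <= 4 * x.2 <= 5 * L ->
  1 <= 40 * ((direction R x).1 * (direction R y).2 -
             (direction R x).2 * (direction R y).1).
Proof.
rewrite /direction /euclidean_norm /= => L_gt0 -> ->.
rewrite -!(ler_int R) -(ltr_int R) in L_gt0 *.
rewrite !intrM rmorphN /= intrD.
move: x.1%:~R x.2%:~R L%:~R L_gt0 => p q l L_gt0 /andP[p1 p2] /andP[q1 q2].
set X := Num.sqrt _; set Y := Num.sqrt _.
have X0 : 0 < X by rewrite sqrtr_gt0; nra.
have Y0 : 0 < Y by rewrite sqrtr_gt0; nra.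
have XL : X <= 4 * l.
  by rewrite -(ler_pXn2r (isT : (0 < 2)%N)) ?nnegrE ?sqr_sqrtr; nra.
have YL : Y <= 5 * l.
  by rewrite -(ler_pXn2r (isT : (0 < 2)%N)) ?nnegrE ?sqr_sqrtr; nra.
have -> : p / X * ((q + l) / Y) - q / X * (p / Y) = p * l / (X * Y).
  by field; rewrite !lt0r_neq0.
by rewrite mulrA ler_pdivlMr ?mulr_gt0// mul1r; nra.
Qed.

Lemma norm_direction_le1 (R : realType) (x : Z2) :
  `|(direction R x).1| <= 1 /\ `|(direction R x).2| <= 1.
Proof.
have le1 (a s : R) : a ^+ 2 <= s -> `|a / Num.sqrt s| <= 1.
  move=> as_; have [->|a0] := eqVneq a 0; first by rewrite mul0r normr0.
  have s0 : 0 < s by rewrite (lt_le_trans _ as_)// exprn_even_gt0.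
  rewrite normrM normfV (ger0_norm (sqrtr_ge0 _)).
  rewrite ler_pdivrMr ?sqrtr_gt0// mul1r.
  by rewrite -sqrtr_sqr ler_wsqrtr.
by split; apply: le1; rewrite ?lerDl ?lerDr sqr_ge0.
Qed.

(** * Walks in one fixed environment *)

Section staircase.
Variables (Omega : Type) (alpha : Omega * Z2 -> Z2) (w : Omega) (A : nat -> Z2).
Hypothesis alphaE : forall p, alpha (w, p) = odometer_arrow (fun n => A n - p).
Hypothesis cA : coherent A.

Definition reaches (p q : Z2) : Prop := exists k, walk alpha w p k = q.

Lemma reaches_trans p q r : reaches p q -> reaches q r -> reaches p r.
Proof. by move=> [k <-] [l <-]; exists (k + l)%N; rewrite walkD. Qed.

Lemma reaches_step p q : reaches (p + alpha (w, p)) q -> reaches p q.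
Proof. by apply: reaches_trans; exists 1. Qed.

(** The column has level at most [n], the row at least [n], and ties go to the row. Allowing column
    level exactly [n] is what covers the centre of a cell. *)
Lemma arrow_e1 n p : ~~ (2 ^+ n.+1 %| (A n.+1 - p).1)%Z ->
  (2 ^+ n %| (A n - p).2)%Z -> alpha (w, p) = e1.
Proof.
move=> h1 h2; rewrite alphaE /odometer_arrow asboolT// => m.
case: (leqP m n) => mn; last first.
  have [d1 _] := coherent_le cA mn.
  move=> /(dvdz_trans (dvdz_exp2l 2 mn)) h.
  case/negP: h1.
  have -> : (A n.+1 - p).1 = (A m - p).1 - ((A m).1 - (A n.+1).1).
    by rewrite /=; ring.
  by rewrite rpredB.
move=> _; have [_ d2] := coherent_le cA mn.
have -> : (A m - p).2 = (A n - p).2 - ((A n).2 - (A m).2) by rewrite /=; ring.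
by rewrite rpredB// (dvdz_trans (dvdz_exp2l 2 mn)).
Qed.

Lemma arrow_e2 n p : (2 ^+ n %| (A n - p).1)%Z ->
  ~~ (2 ^+ n %| (A n - p).2)%Z -> alpha (w, p) = e2.
Proof.
move=> h1 h2; rewrite alphaE /odometer_arrow asboolF// => /(_ n h1).
by rewrite (negbTE h2).
Qed.

(* [p + (u1, u2)] is the upper right corner of the level [n] cell of [p]. *)
Lemma reaches_corner n (u1 u2 : nat) p :
  u1%:Z < 2 ^+ n -> u2%:Z < 2 ^+ n ->
  (2 ^+ n %| (A n - p).1 - u1%:Z)%Z -> (2 ^+ n %| (A n - p).2 - u2%:Z)%Z ->
  reaches p (p + (u1%:Z, u2%:Z)).
Proof.
move: {2}(u1 + u2)%N (leqnn (u1 + u2)) => s.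
(* A line at distance [u < 2 ^ n] before one of level at least [n] has itself such a level only if
   [u = 0]. *)
have notdvd (u : nat) (x : int) : (2 ^+ n %| x - u%:Z)%Z -> u%:Z < 2 ^+ n ->
    (2 ^+ n %| x)%Z -> u = 0%N.
  move=> d1 lt d2; have : (2 ^+ n %| u%:Z)%Z.
    by rewrite (_ : u%:Z = x - (x - u%:Z)); [rewrite rpredB | ring].
  case/dvdzP => q; have := exprn_gt0 n (ltr0n int 2).
  move: (2 ^+ n) lt => L lt L_gt0 uE.
  by have [q0|q1] : q <= 0 \/ 1 <= q; [lia|nia|nia].
elim: s u1 u2 p => [|s IHs] u1 u2 p.
  rewrite leqn0 addn_eq0 => /andP[/eqP -> /eqP ->] *.
  by exists 0%N; rewrite /= -[LHS]addr0.
move=> us lt1 lt2 d1 d2.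
have right v : u1 = v.+1 -> alpha (w, p) = e1 ->
    reaches p (p + (u1%:Z, u2%:Z)).
  move=> u1E aE; apply: reaches_step; rewrite aE.
  have -> : p + (u1%:Z, u2%:Z) = p + e1 + (v%:Z, u2%:Z).
    by rewrite u1E; case: p {d1 d2 aE} => p1 p2; congr pair => /=; lia.
  apply: IHs => //; [lia|lia| |].
  - move: d1; rewrite u1E /= -[v.+1]addn1 PoszD.
    by congr (is_true (_ %| _)%Z); ring.
  - by move: d2; rewrite /= addr0.
have up v : u2 = v.+1 -> alpha (w, p) = e2 ->
    reaches p (p + (u1%:Z, u2%:Z)).
  move=> u2E aE; apply: reaches_step; rewrite aE.
  have -> : p + (u1%:Z, u2%:Z) = p + e2 + (u1%:Z, v%:Z).
    by rewrite u2E; case: p {d1 d2 aE right} => p1 p2; congr pair => /=; lia.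
  apply: IHs => //; [lia|lia| |].
  - by move: d1; rewrite /= addr0.
  - move: d2; rewrite u2E /= -[v.+1]addn1 PoszD.
    by congr (is_true (_ %| _)%Z); ring.
(* On the right side of the cell the arrow points up, on the upper side it points right; strictly
   inside, either arrow stays in the cell. *)
case: u1 us lt1 d1 right up => [|u1] us lt1 d1 right up.
  case: u2 us lt2 d2 {right} up => [|u2] us lt2 d2 up.
    by exists 0%N; rewrite /= -[LHS]addr0.
  apply: (up u2) => //; apply: (arrow_e2 (n := n)).
    by rewrite -[(_ - p).1]subr0.
  by apply/negP => /(notdvd _ _ d2 lt2).
case: u2 us lt2 d2 {up} right (up) => [|u2] us lt2 d2 right up.
  apply: (right u1) => //; apply: (arrow_e1 (n := n)); last first.
    by rewrite -[(_ - p).2]subr0.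
  apply/negP => h; have [h' _] := cA n.
  have : (2 ^+ n %| (A n - p).1)%Z.
    have -> : (A n - p).1 = (A n.+1 - p).1 - ((A n.+1).1 - (A n).1).
      by rewrite /=; ring.
    by rewrite rpredB// (dvdz_trans _ h)// dvdz_exp2l.
  by move/(notdvd _ _ d1 lt1).
have [a1|a2] : alpha (w, p) = e1 \/ alpha (w, p) = e2.
- by rewrite alphaE; exact: odometer_arrow_e1_or_e2.
- exact: (right u1).
- exact: (up u2).
Qed.

(* [p] lies in the lower left quarter of its level [n + 1] cell, whose centre
   [p + (v1, v2)] is the crossing of a column and a row of level exactly [n]. *)
Lemma reaches_staircase n (v1 v2 : nat) p :
  v1%:Z < 2 ^+ n -> v2%:Z < 2 ^+ n ->
  (2 ^+ n.+1 %| (A n.+1 - p).1 - (v1%:Z + 2 ^+ n))%Z ->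
  (2 ^+ n.+1 %| (A n.+1 - p).2 - (v2%:Z + 2 ^+ n))%Z ->
  reaches p (p + (v1%:Z + 2 ^+ n, v2%:Z)) /\
  reaches p (p + (v1%:Z + 2 ^+ n, v2%:Z + 2 ^+ n)).
Proof.
move=> lt1 lt2 d1 d2; have L_gt0 := exprn_gt0 n (ltr0n int 2).
have [l lE] : exists l : nat, 2 ^+ n = l%:Z :> int.
  by exists `|2 ^+ n : int|%N; rewrite abszE ger0_norm// ltW.
have dn : (2 ^+ n %| 2 ^+ n.+1)%Z by exact: dvdz_exp2l.
have [c1 c2] := cA n.
have low x y (v : nat) : (2 ^+ n %| x - y)%Z ->
    (2 ^+ n.+1 %| x - (v%:Z + 2 ^+ n))%Z -> (2 ^+ n %| y - v%:Z)%Z.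
  move=> h1 /(dvdz_trans dn) h2.
  rewrite (_ : y - v%:Z = x - (v%:Z + 2 ^+ n) + 2 ^+ n - (x - y)); last by ring.
  by rewrite rpredB// rpredD.
pose c := p + (v1%:Z, v2%:Z).
have pc : reaches p c.
  apply: (reaches_corner (n := n)) => //.
    by apply: low d1; rewrite (_ : _ - _ = (A n.+1).1 - (A n).1) //=; ring.
  by apply: low d2; rewrite (_ : _ - _ = (A n.+1).2 - (A n).2) //=; ring.
have row j : (j <= l)%N -> reaches c (c + (j%:Z, 0)).
  elim: j => [|j IHj] jl; first by exists 0%N; rewrite /= -[LHS]addr0.
  apply: reaches_trans (IHj (ltnW jl)) _; apply: reaches_step.
  rewrite (arrow_e1 (n := n)).
  - by exists 0%N; rewrite /c; case: (p) => p1 p2; congr pair => /=; lia.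
  (* The column [j < l] steps after the centre is at distance [2 ^ n - j] from the right side of the
     big cell; this lies strictly between 0 and [2 ^ n.+1], so the column has level at most [n]. *)
  - apply/negP => h.
    have := rpredB h d1.
    rewrite (_ : _ - _ = 2 ^+ n - j%:Z); last by rewrite /=; ring.
    rewrite exprS lE => /dvdzP[q]; move: jl.
    by have [q0|q1] : q <= 0 \/ 1 <= q; [lia|nia|nia].
  - have -> : (A n - (c + (j%:Z, 0))).2 = (A n).2 - p.2 - v2%:Z.
      by rewrite /=; ring.
    by apply: low d2; rewrite (_ : _ - _ = (A n.+1).2 - (A n).2) //=; ring.
have p1 : reaches p (p + (v1%:Z + 2 ^+ n, v2%:Z)).
  rewrite (_ : p + _ = c + (l%:Z, 0)).
    exact: reaches_trans (row l (leqnn l)).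
  by rewrite -lE /c; case: (p) => x y; congr pair => /=; ring.
split=> //; apply: reaches_trans p1 _.
set q := p + _; rewrite (_ : p + _ = q + (0%:Z, l%:Z)); last first.
  by rewrite -lE /q; case: (p) => x y; congr pair => /=; ring.
(* The point [q] is on the right side of the big cell, so its corner is straight above. *)
apply: (reaches_corner (n := n.+1)); rewrite -?lE.
- by rewrite exprn_gt0.
- by rewrite exprS; lia.
- by rewrite (_ : _ - _ = (A n.+1 - p).1 - (v1%:Z + 2 ^+ n)) //=; ring.
- by rewrite (_ : _ - _ = (A n.+1 - p).2 - (v2%:Z + 2 ^+ n)) //=; ring.
Qed.

(** Reduced modulo [2 ^ n.+1], [A n.+1 - p] is the offset from [p] to the corner of its cell; both
    digits being 1 places [p] in the lower left quarter. *)
Hypothesis low : forall p N, exists2 n, (N <= n)%N &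
  bit n (A n.+1 - p).1 && bit n (A n.+1 - p).2.

(** The big cell of the componentwise minimum [m] extends at least [2 ^ n] beyond [m] in both
    directions, so for large [n] it contains [x] and [y], whose walks then meet at its corner. *)
Lemma staircase_coalesce : all_coalesce alpha w.
Proof.
move=> x y; pose m : Z2 := (Num.min x.1 y.1, Num.min x.2 y.2).
have [n] := low m (`|x.1| + `|x.2| + `|y.1| + `|y.2|).
move=> le_n /andP[/bitP[v1 lt1 d1] /bitP[v2 lt2 d2]].
have n_lt := ltz_exp2n n.
have corner (z : Z2) : m.1 <= z.1 -> m.2 <= z.2 ->
    z.1 - m.1 <= 2 ^+ n -> z.2 - m.2 <= 2 ^+ n ->
    reaches z (m + (v1%:Z + 2 ^+ n, v2%:Z + 2 ^+ n)).
  move=> m1 m2 z1 z2.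
  have [u1 u1E] : exists u : nat, u%:Z = v1%:Z + 2 ^+ n - (z.1 - m.1).
    by exists `|(v1%:Z + 2 ^+ n - (z.1 - m.1))%R|%N; lia.
  have [u2 u2E] : exists u : nat, u%:Z = v2%:Z + 2 ^+ n - (z.2 - m.2).
    by exists `|(v2%:Z + 2 ^+ n - (z.2 - m.2))%R|%N; lia.
  rewrite (_ : m + _ = z + (u1%:Z, u2%:Z)); last first.
    by rewrite u1E u2E; case: (z) (m) => ? ? [? ?]; congr pair => /=; ring.
  apply: (reaches_corner (n := n.+1)).
  - by rewrite exprS; lia.
  - by rewrite exprS; lia.
  - by rewrite u1E; move: d1; congr (is_true (_ %| _)%Z) => /=; ring.
  - by rewrite u2E; move: d2; congr (is_true (_ %| _)%Z) => /=; ring.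
have [||||k0 k0E] := corner x; rewrite /m/=; [lia..|].
have [||||k1 k1E] := corner y; rewrite /m/=; [lia..|].
by exists k0, k1; rewrite k0E k1E.
Qed.

Lemma staircase_no_direction (R : realType) z :
  ~ has_asymptotic_direction R (walk alpha w z).
Proof.
move=> [V /cvgrPdist_lt cV].
(* Two directions within 1/320 of [V] differ by at most 1/160 per coordinate, so their cross product
   is at most 2/160, less than the 1/40 of [direction_cross]. *)
have [|K _ near_V] := cV (320%:R^-1); first by rewrite invr_gt0 ltr0n.
have a12 q : alpha (w, q) = e1 \/ alpha (w, q) = e2.
  by rewrite alphaE; exact: odometer_arrow_e1_or_e2.
(* The term [K] makes both visits late enough; the other one bounds [z] by a quarter of [2 ^ n],
   which yields the windows of [direction_cross]. *)
have [n] := low z (K + 4 * (`|z.1| + `|z.2|)).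
move=> le_n /andP[/bitP[v1 lt1 d1] /bitP[v2 lt2 d2]].
have n_lt := ltz_exp2n n.
have [[k kE] [l lE]] := reaches_staircase lt1 lt2 d1 d2.
have late i j : walk alpha w z i = j -> z.1 + z.2 + 2 ^+ n <= j.1 + j.2 ->
    (K <= i)%N.
  by move=> <-; rewrite (walk_weight z i a12); lia.
have near_dir i : (K <= i)%N ->
    `|V.1 - (direction R (walk alpha w z i)).1| < 320%:R^-1 /\
    `|V.2 - (direction R (walk alpha w z i)).2| < 320%:R^-1.
  by move=> /near_V /=; rewrite prod_normE gt_max => /andP[].
have [|p1 p2] := near_dir k; first by apply: late kE _ => /=; lia.
have [|q1 q2] := near_dir l; first by apply: late lE _ => /=; lia.
rewrite kE in p1 p2; rewrite lE in q1 q2.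
set P := z + (_, v2%:Z) in p1 p2; set Q := z + _ in q1 q2.
have [_ P2] := norm_direction_le1 R P; have [P1 _] := norm_direction_le1 R P.
have : 1 <= 40 * ((direction R P).1 * (direction R Q).2 -
                  (direction R P).2 * (direction R Q).1).
  apply: (@direction_cross R _ _ (2 ^+ n)); rewrite /P /Q/= ?exprn_gt0//.
  - by ring.
  - by lia.
  - by lia.
move: (direction R P) (direction R Q) P1 P2 p1 p2 q1 q2 => [a b] [c d] /=.
rewrite !ltr_norml !ler_norml.
move=> /andP[a1 a2] /andP[b1 b2] /andP[? ?] /andP[? ?] /andP[? ?] /andP[? ?].
have -> : a * d - b * c = a * (d - b) + b * (a - c) by ring.
have prod_le (x t : R) : -1 <= x -> x <= 1 ->
    - 160%:R^-1 <= t -> t <= 160%:R^-1 -> x * t <= 160%:R^-1 by nra.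
have := prod_le a (d - b) a1 a2; have := prod_le b (a - c) b1 b2.
lra.
Qed.

End staircase.

(** * Base 4 digits as pairs of binary digits *)

(* For [j = floor (4 ^ n * x)] with [0 <= x < 1], the base 4 digits of [x] are
   read as pairs of bits, the leading digit having the least weight, so that
   [residue n j] is the reduction modulo [2 ^ n] of a 2-adic vector. *)
Fixpoint residue (n : nat) (j : int) : Z2 :=
  if n is n'.+1
  then residue n' (j %/ 4)%Z +
       (2 ^+ n' * ((j %% 4)%Z %% 2)%Z, 2 ^+ n' * ((j %% 4)%Z %/ 2)%Z)
  else 0.

Lemma residue_ge0_lt n j : (0 <= (residue n j).1 < 2 ^+ n) &&
  (0 <= (residue n j).2 < 2 ^+ n).
Proof.
elim: n j => [//|n IHn] j; have /andP[] := IHn (j %/ 4)%Z.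
have d1 : 0 <= ((j %% 4)%Z %% 2)%Z <= 1 by lia.
have d2 : 0 <= ((j %% 4)%Z %/ 2)%Z <= 1 by lia.
rewrite /= exprS; have := exprn_gt0 n (ltr0n int 2).
move: (_ %% 2)%Z (_ %/ 2)%Z (2 ^+ n) d1 d2 => x y L.
by move=> /andP[? ?] /andP[? ?] ? /andP[? ?] /andP[? ?]; nia.
Qed.

Lemma dvdz_digit (L r e a : int) : 0 < L -> 0 <= r < L -> 0 <= e <= 1 ->
  (2 * L %| r + L * e - a)%Z = (L %| r - a)%Z && (e == ((a %/ L)%Z %% 2)%Z).
Proof.
move=> L_gt0 rL e01.
have L_neq0 : L != 0 by rewrite gt_eqF.
have r_div : (r %/ L)%Z = 0 by rewrite divz_small// abszE gtr0_norm.
apply/idP/andP => [/dvdzP[q qE]|[/dvdzP[q qE] /eqP eE]].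
- have aE : a = (e - 2 * q) * L + r.
    by rewrite (_ : _ * L = L * e - q * (2 * L)); [rewrite -qE|]; ring.
  split; first by apply/dvdzP; exists (2 * q - e); rewrite aE; ring.
  apply/eqP; rewrite aE divzMDl// r_div addr0; lia.
- have aE : a = (- q) * L + r by rewrite mulNr -qE; ring.
  have {}eE : e = (- q %% 2)%Z.
    by rewrite eE aE divzMDl// r_div addr0; lia.
  apply/dvdzP; exists ((q + e) %/ 2)%Z.
  have -> : r + L * e - a = (q + e) * L by rewrite aE; ring.
  by rewrite mulrA; congr (_ * _); lia.
Qed.

Definition cong (n : nat) (a b : Z2) : bool :=
  (2 ^+ n %| (a - b).1)%Z && (2 ^+ n %| (a - b).2)%Z.

(** Indices below [4 ^ n] enumerate the classes modulo [2 ^ n] without repetition, so that a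
    cylinder will correspond to a single interval of length [4 ^- n]. *)
Lemma cong_residue n a : exists2 i : int, 0 <= i < 4 ^+ n &
  forall j, 0 <= j < 4 ^+ n -> cong n (residue n j) a = (j == i).
Proof.
elim: n => [|n [i i4 iP]].
  exists 0; first by rewrite expr0.
  by move=> j; rewrite /cong !expr0 !dvd1z => ?; lia.
pose e1 := ((a.1 %/ 2 ^+ n)%Z %% 2)%Z; pose e2 := ((a.2 %/ 2 ^+ n)%Z %% 2)%Z.
have he1 : 0 <= e1 <= 1 by rewrite /e1; lia.
have he2 : 0 <= e2 <= 1 by rewrite /e2; lia.
(* The appended base 4 digit encodes the digits of weight [2 ^ n] of both coordinates. *)
exists (4 * i + e1 + 2 * e2); first by rewrite exprS; lia.
move=> j j4; have := iP (j %/ 4)%Z; rewrite /cong /= exprS.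
have /andP[r1 r2] := residue_ge0_lt n (j %/ 4)%Z.
rewrite !dvdz_digit ?exprn_gt0//; [|lia|lia].
rewrite andbACA => ->; last by move: j4; rewrite exprS; lia.
by rewrite -/e1 -/e2; lia.
Qed.

Lemma residue_step n j :
  (2 ^+ n %| (residue n.+1 j).1 - (residue n (j %/ 4)%Z).1)%Z /\
  (2 ^+ n %| (residue n.+1 j).2 - (residue n (j %/ 4)%Z).2)%Z.
Proof. by split; rewrite /= addrAC subrr add0r dvdz_mulr. Qed.

(** Refining the approximation of [x] only appends a base 4 digit; hence addresses are coherent. *)
Lemma floor_quarter (R : realType) (n : nat) (x : R) :
  (Num.floor (4 ^+ n.+1 * x) %/ 4)%Z = Num.floor (4 ^+ n * x).
Proof.
rewrite exprS -mulrA; move: (_ * x) => y.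
have /andP[a1 a2] := floor_itv y.
have /andP[b1 b2] := floor_itv (4 * y).
move: (Num.floor _) (Num.floor _) a1 a2 b1 b2 => f g a1 a2 b1 b2.
have h1 : f%:~R < (4 * (g + 1))%:~R :> R by rewrite intrM; lra.
have h2 : (4 * g)%:~R < (f + 1)%:~R :> R by rewrite intrM; lra.
by rewrite !ltr_int in h1 h2; lia.
Qed.

Lemma cong_refl n a : cong n a a.
Proof. by rewrite /cong subrr !dvdz0. Qed.

Lemma cong_sym n a b : cong n a b -> cong n b a.
Proof. by rewrite /cong -opprB /= !rpredN. Qed.

Lemma cong_trans n a b c : cong n a b -> cong n b c -> cong n a c.
Proof.
move=> /andP[h1 h2] /andP[h3 h4]; rewrite /cong.
have -> : a - c = (a - b) + (b - c) by rewrite addrA subrK.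
by rewrite [X in X && _](rpredD h1 h3) [X in _ && X](rpredD h2 h4).
Qed.

Lemma cong_le m n a b : (m <= n)%N -> cong n a b -> cong m a b.
Proof.
by move=> mn /andP[h1 h2]; rewrite /cong !(dvdz_trans (dvdz_exp2l 2 mn)).
Qed.

Lemma cong_translate n a b z : cong n (a - z) (b - z) = cong n a b.
Proof. by rewrite /cong opprB addrA subrK. Qed.

(** * The space, its sigma-algebra and the action *)

Section odometer.
Variable R : realType.

(** The lattice component stores the translation, so the action is exact and no carries have to be
    performed on the digits of the real component. *)
Definition address (w : R * Z2) (n : nat) : Z2 :=
  residue n (Num.floor (4 ^+ n * w.1)) - w.2.

Definition cylinder n (a : Z2) : set (R * Z2) :=
  [set w | cong n (address w n) a].

Definition cylinders : set (set (R * Z2)) :=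
  [set C | C = set0 \/ exists n a, C = cylinder n a].

(* [(x, k)] represents the 2-adic vector with reductions [address (x, k) n]; as
   the sigma-algebra depends on addresses only, points with the same addresses
   need not be identified. *)
Definition odometer : Type := g_sigma_algebraType cylinders.
HB.instance Definition _ := Measurable.on odometer.

Definition translate (z : Z2) (w : odometer) : odometer := (w.1, w.2 + z).

Lemma address_translate z w n : address (translate z w) n = address w n - z.
Proof. by rewrite /address opprD addrA. Qed.

Lemma coherent_address w : coherent (address w).
Proof.
move=> n; rewrite /address -(floor_quarter n).
have [h1 h2] := residue_step n (Num.floor (4 ^+ n.+1 * w.1)).
by split; [move: h1|move: h2]; congr (is_true (_ %| _)%Z); rewrite /=; ring.
Qed.

Lemma cong_address w m n : (m <= n)%N -> cong m (address w n) (address w m).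
Proof.
move=> mn; rewrite /cong.
by have [-> ->] := coherent_le (coherent_address w) mn.
Qed.

Lemma cylinder0 a : cylinder 0 a = setT.
Proof. by apply/seteqP; split=> // w _; rewrite /cylinder /= /cong !dvd1z. Qed.

Lemma preimage_cylinder z n a :
  translate z @^-1` cylinder n a = cylinder n (a + z).
Proof.
apply/seteqP; split=> w; rewrite /cylinder /= address_translate.
  by rewrite -{1}(addrK z a) cong_translate.
by rewrite -{2}(addrK z a) cong_translate.
Qed.

(** As balls of an ultrametric, two cylinders are nested or disjoint. *)
Lemma setI_closed_cylinders : setI_closed cylinders.
Proof.
move=> C D [->|[m [a ->]]]; first by move=> _; left; rewrite set0I.
move=> [->|[n [b ->]]]; first by left; rewrite setI0.
wlog mn : m n a b / (m <= n)%N.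
  by move=> h; case: (leqP m n) => [|/ltnW] /h//; rewrite setIC; exact.
have [ab|ab] := boolP (cong m b a).
  right; exists n, b; rewrite setIidr// => w /= wb.
  apply: cong_trans ab; apply: cong_trans (cong_le mn wb); apply: cong_sym.
  exact: cong_address.
left; apply/seteqP; split=> // w [/= wa wb]; case/negP: ab.
apply: cong_trans wa; apply: cong_sym.
by apply: cong_trans (cong_le mn wb); apply: cong_sym; exact: cong_address.
Qed.

Lemma measurable_cylinder n a : measurable (cylinder n a : set odometer).
Proof. by apply: sub_sigma_algebra; right; exists n, a. Qed.

Lemma measurable_address n (B : set Z2) :
  (forall a b, cong n a b -> B a -> B b) ->
  measurable ([set w | B (address w n)] : set odometer).
Proof.
move=> cB; rewrite (_ : [set w | _] =
    \bigcup_(a : Z2) (if `[< B a >] then cylinder n a else set0)).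
  apply: countable_bigcupT_measurable => [|a]; first exact: countableP.
  by case: ifP => // _; exact: measurable_cylinder.
apply/seteqP; split=> w /=.
  move=> Bw; exists (address w n) => //; rewrite asboolT//; exact: cong_refl.
case=> a _; case: asboolP => // Ba wa; apply: cB Ba; exact: cong_sym.
Qed.

Lemma measurable_translate z : measurable_fun setT (translate z).
Proof.
apply: (@measurability _ _ odometer odometer setT (translate z)
  cylinders) => //.
move=> _ [_ [->|[n [a ->]]] <-].
  by rewrite preimage_set0 setI0.
by rewrite setTI preimage_cylinder; exact: measurable_cylinder.
Qed.

End odometer.

(** * The probability, an image of Lebesgue measure on the unit interval *)

Section odometer_prob.
Variable R : realType.

Definition base_point (x : measurableTypeR R) : odometer R := (x, 0).

Lemma floor_fiberE (n : nat) (j : int) :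
  [set x : R | Num.floor (4 ^+ n * x) = j] =
  `[j%:~R / 4 ^+ n, (j + 1)%:~R / 4 ^+ n[%classic.
Proof.
have L_gt0 : 0 < 4 ^+ n :> R by rewrite exprn_gt0.
apply/seteqP; split=> x /=; rewrite in_itv /= ler_pdivrMr// ltr_pdivlMr// mulrC.
  by move=> <-; exact: floor_itv.
by move=> h; apply: floor_def.
Qed.

Lemma measurable_base_point : measurable_fun setT base_point.
Proof.
apply: (@measurability _ _ (measurableTypeR R) (odometer R) setT base_point
  (@cylinders R)) => //.
move=> _ [_ [->|[n [a ->]]] <-]; first by rewrite preimage_set0 setI0.
rewrite setTI (_ : _ @^-1` _ = \bigcup_(j : int)
    if cong n (residue n j) a
    then [set x | Num.floor (4 ^+ n * x) = j] else set0).
  apply: countable_bigcupT_measurable => [|j]; first exact: countableP.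
  by case: ifP => _ //; rewrite floor_fiberE; exact: measurable_itv.
apply/seteqP; split=> x; rewrite /cylinder /address /= subr0.
  by move=> ca; exists (Num.floor (4 ^+ n * x)) => //; rewrite ca.
by case=> j _; case: ifP => // ca /= ->.
Qed.

HB.instance Definition _ :=
  isMeasurableFun.Build _ _ _ _ base_point measurable_base_point.

Definition lebesgue01 : set (measurableTypeR R) -> \bar R :=
  mrestr (@lebesgue_measure R) (measurable_itv `[0, 1[).

HB.instance Definition _ := Measure.on lebesgue01.

Lemma lebesgue01T : lebesgue01 setT = 1%E.
Proof.
rewrite /lebesgue01 /mrestr setTI lebesgue_measure_itv /= lte_fin ltr01.
by rewrite oppr0 adde0.
Qed.

HB.instance Definition _ :=
  Measure_isProbability.Build _ _ _ lebesgue01 lebesgue01T.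

Definition odometer_prob : probability (odometer R) R :=
  distribution lebesgue01 base_point.

Lemma odometer_prob_cylinder n a :
  odometer_prob (cylinder n a) = ((4 ^+ n)^-1)%:E.
Proof.
have [i /andP[i0 i4] iP] := cong_residue n a.
have L_gt0 : 0 < 4 ^+ n :> R by rewrite exprn_gt0.
have L_int : 4 ^+ n = (4 ^+ n : int)%:~R :> R by rewrite rmorphXn.
have floor01 (x : R) : 0 <= x < 1 -> 0 <= Num.floor (4 ^+ n * x) < 4 ^+ n.
  move=> /andP[x0 x1]; rewrite floor_ge0 mulr_ge0 ?(ltW L_gt0)//=.
  by rewrite floor_lt_int -L_int gtr_pMr.
have i_itv : 0 <= i%:~R / 4 ^+ n :> R /\ (i + 1)%:~R / 4 ^+ n <= 1 :> R.
  rewrite divr_ge0 ?ler0z ?(ltW L_gt0)//; split=> //.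
  rewrite ler_pdivrMr// mul1r L_int ler_int; lia.
transitivity (lebesgue_measure
    (`[i%:~R / 4 ^+ n, (i + 1)%:~R / 4 ^+ n[%classic : set R)).
  congr (lebesgue_measure _); apply/seteqP; split=> x.
    rewrite /= in_itv /= => -[] /[swap] x01.
    rewrite /cylinder /= /address /= subr0 iP ?floor01// => /eqP xi.
    have : [set x : R | Num.floor (4 ^+ n * x) = i] x by [].
    by rewrite floor_fiberE.
  move=> xi; have x01 : 0 <= x < 1.
    by move: xi; rewrite /= in_itv /= => /andP[? ?]; case: i_itv => ? ?; lra.
  split; last by rewrite /= in_itv.
  rewrite -floor_fiberE /= in xi.
  by rewrite /cylinder /= /address /= subr0 iP ?floor01// xi.
rewrite lebesgue_measure_itv /= lte_fin ltr_pM2r ?invr_gt0//.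
rewrite ltr_int ltrDl ltr01.
by rewrite -EFinB -mulrBl intrD addrAC subrr add0r mul1r.
Qed.

End odometer_prob.

(** * Invariance, ergodicity and recurrence of digits *)

Lemma cong_bit n a b : cong n.+1 a b =
  [&& cong n a b, bit n a.1 == bit n b.1 & bit n a.2 == bit n b.2].
Proof. by rewrite /cong !dvdz_bit /= andbACA -andbA. Qed.

Section half.
Local Open Scope ereal_scope.
Context d (T : measurableType d) (R : realType) (P : probability T R).

(** The map exchanges [B] inside [D] with [B] outside [D], so both halves have the same mass. *)
Lemma measure_preserving_half (f : T -> T) (B D : set T) :
  measure_preserving P f -> measurable B -> measurable D ->
  f @^-1` B = B -> f @^-1` D = ~` D -> P (B `&` D) = (2^-1)%:E * P B.
Proof.
move=> [_ Pf] mB mD fB fD.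
have PD : P (B `\` D) = P (B `&` D).
  by rewrite -[RHS]Pf ?preimage_setI ?fB ?fD//; exact: measurableI.
have fin : P (B `&` D) \is a fin_num by exact/fin_num_measure/measurableI.
have -> : P B = P (B `&` D) + P (B `&` D) by rewrite -{1}PD; exact: measureDI.
rewrite -(fineK fin) -EFinD -EFinM.
by congr EFin; field.
Qed.

End half.

Section dynamics.
Variable R : realType.
Variable P : probability (odometer R) R.
Hypothesis Pcylinder : forall n a, P (cylinder n a) = ((4 ^+ n)^-1)%:E.

HB.instance Definition _ (z : Z2) :=
  isMeasurableFun.Build _ _ (odometer R) (odometer R) (@translate R z)
    (measurable_translate z).

Lemma cylinders_unique (m1 m2 : {measure set (odometer R) -> \bar R}) :
  (m1 setT < +oo)%E -> (forall n a, m1 (cylinder n a) = m2 (cylinder n a)) ->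
  forall A, measurable A -> m1 A = m2 A.
Proof.
move=> m1T m12 A mA.
apply: (@measure_unique _ _ (odometer R) (@cylinders R) (fun=> setT)) => //.
- exact: setI_closed_cylinders.
- by move=> _; right; exists 0%N, 0; rewrite cylinder0.
- by rewrite bigcup_const.
- by move=> _ [->|[n [a ->]]]; rewrite ?measure0.
Qed.

(** Translations permute the cylinders of each level, which have equal mass. The law comes from
    points with zero lattice component, but measurable sets see only addresses. *)
Lemma measure_preserving_translate z : measure_preserving P (@translate R z).
Proof.
split=> [|A mA]; first exact: measurable_translate.
apply/esym.
apply: (@cylinders_unique P (distribution P (@translate R z))) => //.
  by rewrite /= probability_setT ltry.
move=> n a; rewrite /= /distribution /pushforward.
by rewrite preimage_cylinder !Pcylinder.
Qed.

Definition bit1 n (b : bool) : set (odometer R) :=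
  [set w | bit n (address w n.+1).1 = b].

Definition bit2 n (b : bool) : set (odometer R) :=
  [set w | bit n (address w n.+1).2 = b].

Lemma measurable_bit1 n b : measurable (bit1 n b).
Proof.
apply: (measurable_address (B := [set a : Z2 | bit n a.1 = b])) => x y.
by move=> /andP[h _] /= <-; rewrite (bit_cong h).
Qed.

Lemma measurable_bit2 n b : measurable (bit2 n b).
Proof.
apply: (measurable_address (B := [set a : Z2 | bit n a.2 = b])) => x y.
by move=> /andP[_ h] /= <-; rewrite (bit_cong h).
Qed.

Lemma preimage_bit1 z n b : @translate R z @^-1` bit1 n b =
  [set w | bit n ((address w n.+1).1 - z.1) = b].
Proof.
by apply/seteqP; split=> w; rewrite /preimage /bit1 /mkset address_translate.
Qed.

Lemma preimage_bit2 z n b : @translate R z @^-1` bit2 n b =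
  [set w | bit n ((address w n.+1).2 - z.2) = b].
Proof.
by apply/seteqP; split=> w; rewrite /preimage /bit2 /mkset address_translate.
Qed.

Lemma preimage_bit1_id z n b : (2 ^+ n.+1 %| z.1)%Z ->
  @translate R z @^-1` bit1 n b = bit1 n b.
Proof.
move=> zn; rewrite preimage_bit1; apply/seteqP; split=> w; rewrite /bit1 /mkset.
  by rewrite (@bit_cong n _ (address w n.+1).1)// addrAC subrr add0r rpredN.
by move=> <-; apply: bit_cong; rewrite addrAC subrr add0r rpredN.
Qed.

Lemma preimage_bit2_id z n b : (2 ^+ n.+1 %| z.2)%Z ->
  @translate R z @^-1` bit2 n b = bit2 n b.
Proof.
move=> zn; rewrite preimage_bit2; apply/seteqP; split=> w; rewrite /bit2 /mkset.
  by rewrite (@bit_cong n _ (address w n.+1).2)// addrAC subrr add0r rpredN.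
by move=> <-; apply: bit_cong; rewrite addrAC subrr add0r rpredN.
Qed.

(** Translating by [2 ^ n] along one axis preserves [B] and flips one of the two digits, so each
    digit halves the mass. Invariance under this sublattice holds for events on digits below [n] and
    for invariant sets cut by a level [n] cylinder; the first case serves recurrence, the second
    ergodicity. *)
Lemma prob_bits n (B : set (odometer R)) b1 b2 : measurable B ->
  (forall z : Z2, (2 ^+ n %| z.1)%Z -> (2 ^+ n %| z.2)%Z ->
    @translate R z @^-1` B = B) ->
  P (B `&` bit1 n b1 `&` bit2 n b2) = ((4^-1)%:E * P B)%E.
Proof.
move=> mB invB.
have mB1 := measurableI _ _ mB (measurable_bit1 n b1).
have neg (x b : bool) : (~~ x = b) = ~ (x = b).
  by apply/propext; split; case: x; case: b.
rewrite (measure_preserving_half (measure_preserving_translate (0, 2 ^+ n)))//.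
- have mp := measure_preserving_translate (2 ^+ n, 0).
  rewrite (measure_preserving_half mp)//.
  + by rewrite muleA -EFinM; congr (_%:E * _)%E; field.
  + exact: measurable_bit1.
  + by apply: invB => /=; rewrite ?dvdzz ?dvdz0.
  + rewrite preimage_bit1; apply/seteqP; split=> w;
      by rewrite /bit1 /setC /mkset bitB neg.
- exact: measurable_bit2.
- rewrite preimage_setI invB//; congr (_ `&` _).
  rewrite preimage_bit1; apply/seteqP; split=> w;
    by rewrite /bit1 /mkset subr0.
- rewrite preimage_bit2; apply/seteqP; split=> w;
    by rewrite /bit2 /setC /mkset bitB neg.
Qed.

(** Passing to the next level prescribes two more digits, at a factor 1/4 by [prob_bits]. *)
Lemma prob_setI_cylinder (B : set (odometer R)) n a : measurable B ->
  (forall z, @translate R z @^-1` B = B) ->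
  P (B `&` cylinder n a) = (((4 ^+ n)^-1)%:E * P B)%E.
Proof.
move=> mB invB; elim: n => [|n IHn].
  by rewrite cylinder0 setIT expr0 invr1 mul1e.
have -> : B `&` cylinder n.+1 a =
    B `&` cylinder n a `&` bit1 n (bit n a.1) `&` bit2 n (bit n a.2).
  rewrite -!setIA; congr (_ `&` _); apply/seteqP; split=> w.
    rewrite /cylinder /bit1 /bit2 /= cong_bit => /and3P[h /eqP -> /eqP ->].
    by split=> //; apply: cong_trans h; apply: cong_sym; exact: cong_address.
  rewrite /cylinder /bit1 /bit2 /= cong_bit => -[h [-> ->]].
  rewrite !eqxx !andbT.
  by apply: cong_trans h; exact: cong_address.
rewrite prob_bits.
- by rewrite IHn muleA -EFinM -invfM exprS.
- by apply: measurableI => //; exact: measurable_cylinder.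
- move=> z z1 z2; rewrite preimage_setI invB preimage_cylinder; congr (_ `&` _).
  apply/seteqP; split=> w wa; apply: cong_trans wa _.
    by rewrite /cong addrAC subrr add0r z1 z2.
  by apply: cong_sym; rewrite /cong addrAC subrr add0r z1 z2.
Qed.

(* By invariance [A] is independent of all cylinders, hence of itself. *)
Lemma ergodic_translate : ergodic P (@translate R).
Proof.
move=> A mA invA.
have finA : P A \is a fin_num by exact: fin_num_measure.
have A_ge0 : 0 <= fine (P A) by exact: fine_ge0.
have m12 C : measurable C -> P (C `&` A) = ((fine (P A))%:E * P C)%E.
  apply: (@cylinders_unique (mrestr P mA) (mscale (NngNum A_ge0) P)).
    by rewrite /= /mrestr setTI ltey_eq finA.
  move=> n a; rewrite /= /mrestr /mscale /= setIC prob_setI_cylinder//.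
  by rewrite Pcylinder fineK// muleC.
have := m12 A mA; rewrite setIid -(fineK finA) -EFinM.
move: (fine (P A)) => x [/eqP].
rewrite eq_sym -subr_eq0 -{3}(mulr1 x) -mulrBr mulf_eq0 subr_eq0.
by case/orP => /eqP ->; [left|right].
Qed.

Definition no_bits_between N m : set (odometer R) :=
  [set w | forall n, (N <= n < N + m)%N -> ~ (bit1 n true `&` bit2 n true) w].

Lemma no_bits_betweenS N m : no_bits_between N m.+1 =
  no_bits_between N m `\` (bit1 (N + m) true `&` bit2 (N + m) true).
Proof.
apply/seteqP; split=> [w h|w [h hm] n].
  split=> [n nm|]; apply: h; lia.
rewrite addnS ltnS => /andP[Nn]; rewrite leq_eqVlt => /predU1P[->//|nm].
by apply: h; rewrite Nn.
Qed.

Lemma measurable_no_bits_between N m : measurable (no_bits_between N m).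
Proof.
elim: m => [|m IHm].
  rewrite (_ : no_bits_between N 0 = setT)//.
  by apply/seteqP; split=> // w _ n; lia.
rewrite no_bits_betweenS; apply: measurableD => //; apply: measurableI.
  exact: measurable_bit1.
exact: measurable_bit2.
Qed.

(** The event up to level [N + m] is invariant under translations by multiples of [2 ^ (N + m)], so
    [prob_bits] applies and the next level fails with conditional probability 3/4. *)
Lemma prob_no_bits_between N m : P (no_bits_between N m) = ((3 / 4) ^+ m)%:E.
Proof.
elim: m => [|m IHm].
  rewrite (_ : no_bits_between N 0 = setT) ?probability_setT//.
  by apply/seteqP; split=> // w _ n; lia.
have mF := measurable_no_bits_between N m.
have mE : measurable (bit1 (N + m) true `&` bit2 (N + m) true).
  by apply: measurableI; [exact: measurable_bit1|exact: measurable_bit2].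
rewrite no_bits_betweenS measureD//; last by rewrite /= IHm ltry.
rewrite setIA /= prob_bits//.
  by rewrite IHm -EFinM -EFinB; congr EFin; rewrite exprS; field.
move=> z z1 z2.
have bitsE w n : (N <= n < N + m)%N ->
    (bit1 n true `&` bit2 n true) (translate z w) =
    (bit1 n true `&` bit2 n true) w.
  move=> /andP[_ nm].
  rewrite -[LHS]/((translate z @^-1` (bit1 n true `&` bit2 n true)) w).
  rewrite preimage_setI.
  rewrite preimage_bit1_id ?preimage_bit2_id//.
  - exact: dvdz_trans (dvdz_exp2l 2 nm) z2.
  - exact: dvdz_trans (dvdz_exp2l 2 nm) z1.
by apply/seteqP; split=> w h n nm; have := h n nm; rewrite bitsE.
Qed.

Definition no_bits_after N : set (odometer R) :=
  [set w | forall n, (N <= n)%N -> ~ (bit1 n true `&` bit2 n true) w].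

Lemma no_bits_afterE N : no_bits_after N = \bigcap_m no_bits_between N m.
Proof.
apply/seteqP; split=> [w Bw m _ n /andP[Nn _]|w Bw n Nn]; first exact: Bw.
by apply: (Bw n.+1 I); rewrite Nn ltn_addl.
Qed.

Lemma measurable_no_bits_after N : measurable (no_bits_after N).
Proof.
rewrite no_bits_afterE; apply: bigcapT_measurable => m.
exact: measurable_no_bits_between.
Qed.

Lemma prob_no_bits_after N : P (no_bits_after N) = 0%E.
Proof.
have mB := measurable_no_bits_after N.
have PB m : fine (P (no_bits_after N)) <= (3 / 4) ^+ m.
  rewrite -lee_fin fineK ?fin_num_measure// -(prob_no_bits_between N m).
  rewrite le_measure ?inE//; first exact: measurable_no_bits_between.
  by rewrite no_bits_afterE; apply: bigcap_inf.
rewrite -(fineK (fin_num_measure P _ mB)); congr EFin.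
apply/eqP; rewrite eq_le fine_ge0// andbT leNgt; apply/negP => PB_gt0.
have /cvgrPdist_lt/(_ _ PB_gt0)[m _ /(_ m (leqnn m))] :
    (3 / 4 : R) ^+ n @[n --> \oo] --> 0.
  by apply: cvg_expr; rewrite ger0_norm; lra.
by rewrite /= sub0r normrN ger0_norm ?exprn_ge0// ltNge PB.
Qed.

Lemma ae_bits : {ae P, forall w, forall z N, exists2 n, (N <= n)%N &
  (bit1 n true `&` bit2 n true) (@translate R z w)}.
Proof.
pose good (zN : Z2 * nat) (w : odometer R) := exists2 n, (zN.2 <= n)%N &
  (bit1 n true `&` bit2 n true) (translate zN.1 w).
have goodP zN : {ae P, forall w, good zN w}.
  have mB := measurable_no_bits_after zN.2.
  exists (translate zN.1 @^-1` no_bits_after zN.2); split.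
  - by rewrite -[X in measurable X]setTI; exact: measurable_translate.
  - rewrite (measure_preserving_translate zN.1).2//.
    exact: prob_no_bits_after.
  - by move=> w /= ngood n Nn bits; apply: ngood; exists n.
(* Countably many pairs [(z, N)] are merged through their codes; numbers coding no pair get a
   trivial event. *)
have : {ae P, forall w, forall i,
    if unpickle i is Some zN then good zN w else True}.
  by apply: ae_foralln => i; case: unpickle => [zN|]; [exact: goodP|exact: aeW].
apply: filterS => w h z N; have := h (pickle (z, N)); rewrite pickleK; exact.
Qed.

End dynamics.

(** * Joint measurability of the arrow map, and the theorem *)

Section arrow.
Variable R : realType.

Definition odometer_alpha (p : odometer R * Z2) : Z2 :=
  odometer_arrow (fun n => address p.1 n - p.2).

Lemma measurable_odometer_alpha_e1 z :
  measurable [set w | odometer_alpha (w, z) = e1].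
Proof.
rewrite (_ : [set w | _] = \bigcap_n [set w |
    (2 ^+ n %| (address w n - z).1)%Z -> (2 ^+ n %| (address w n - z).2)%Z]).
  apply: bigcapT_measurable => n.
  apply: (measurable_address (B := [set a : Z2 |
    (2 ^+ n %| (a - z).1)%Z -> (2 ^+ n %| (a - z).2)%Z])).
  move=> a b; rewrite -(@cong_translate n a b z) => /andP[ab1 ab2] /= Ba zb.
  have -> : b.2 - z.2 = (a - z).2 - ((a - z).2 - (b - z).2) by rewrite /=; ring.
  rewrite rpredB// Ba//.
  have -> : a.1 - z.1 = (b - z).1 + ((a - z).1 - (b - z).1) by rewrite /=; ring.
  by rewrite rpredD.
apply/seteqP; split=> w; rewrite /odometer_alpha /odometer_arrow /mkset.
  by case: asboolP => // h _ n _; exact: h.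
by move=> h; rewrite asboolT// => n; exact: h.
Qed.

Lemma arrow_map_odometer_alpha : arrow_map odometer_alpha.
Proof.
split=> [_ Y _|p]; last exact: odometer_arrow_e1_or_e2.
(* The preimage is cut into slices over the countable lattice; each slice depends only on which of
   [e1] and [e2] lie in [Y]. *)
rewrite setTI (_ : _ @^-1` Y = \bigcup_z
    (((if `[< Y e1 >] then [set w | odometer_alpha (w, z) = e1] else set0) `|`
      (if `[< Y e2 >] then ~` [set w | odometer_alpha (w, z) = e1] else set0))
     `*` [set z])).
  apply: countable_bigcupT_measurable => [|z]; first exact: countableP.
  apply: measurableX => //; apply: measurableU; case: ifP => // _.
    exact: measurable_odometer_alpha_e1.
  by apply: measurableC; exact: measurable_odometer_alpha_e1.
apply/seteqP; split=> [[w z]|[w z]] /=.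
  move=> Yw; exists z => //; split=> //=.
  have := odometer_arrow_e1_or_e2 (fun n => address w n - z).
  rewrite -/(odometer_alpha (w, z)) => -[] wE; rewrite wE in Yw.
    by left; rewrite asboolT.
  by right; rewrite asboolT //= wE.
case=> z' _ [/= h /= zE]; move: h; rewrite -zE.
case=> []; case: asboolP => // Ye /=; first by move=> ->.
have := odometer_arrow_e1_or_e2 (fun n => address w n - z).
by rewrite -/(odometer_alpha (w, z)) => -[] ->.
Qed.

End arrow.

Theorem theorem2p16 (R : realType) :
  exists (d : measure_display) (Omega : measurableType d)
         (P : probability Omega R) (T : Z2 -> Omega -> Omega)
         (alpha : Omega * Z2 -> Z2),
    [/\ dynamical_system P T,
        ergodic P T,
        arrow_map alpha,
        stationary P T alpha
      & {ae P, forall w : Omega,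
          all_coalesce alpha w /\
          forall z : Z2, ~ has_asymptotic_direction R (walk alpha w z)}].
Proof.
have PC := @odometer_prob_cylinder R.
exists _, (odometer R), (odometer_prob R), (@translate R), (@odometer_alpha R).
split.
- split=> [|y z|z].
  + by apply/funext => -[x k]; rewrite /translate /= addr0.
  + by apply/funext => -[x k]; rewrite /translate /= [y + z]addrC addrA.
  + exact: measure_preserving_translate.
- exact: ergodic_translate.
- exact: arrow_map_odometer_alpha.
- apply: aeW => w z; rewrite /odometer_alpha; congr odometer_arrow.
  by apply/funext => n /=; rewrite address_translate subr0.
apply: filterS (ae_bits PC) => w bits.
have cA := @coherent_address R w.
have low p N : exists2 n, (N <= n)%N &
    bit n (address w n.+1 - p).1 && bit n (address w n.+1 - p).2.
  have [n Nn [b1 b2]] := bits p N; exists n => //; apply/andP.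
  by rewrite /bit1 /bit2 /mkset !address_translate in b1 b2.
split=> [|z].
  exact: (staircase_coalesce (alpha := @odometer_alpha R) _ cA low).
exact: (staircase_no_direction (alpha := @odometer_alpha R) _ cA low).
Qed.
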